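(* Let $q:\mathbb R^{n+m}\to\mathbb R$ with $q\in\mathcal C^1(\mathbb R^{n+m};L_{1,q})$, let $(x,y)\in\mathbb R^n\times\mathbb R^m$, $\eta>0$, $\mu\ge0$, and let $$\tilde\nabla_xq_{\eta,\mu}(x,y)=\frac{q(x+\eta u,y+\mu v)-q(x,y)}{\eta}\,u,$$ where $u\sim\mathcal N(0,I_n)$ and $v\sim\mathcal N(0,I_m)$ are independent. Then $$\mathbb E\|\tilde\nabla_xq_{\eta,\mu}(x,y)\|^2\le L_{1,q}^2\Big(\eta^2(n+6)^3+\frac{\mu^4}{\eta^2}n(m+4)^2\Big)+4(n+2)\|\nabla_xq(x,y)\|^2+\frac{4\mu^2}{\eta^2}n\|\nabla_yq(x,y)\|^2.$$
   Context: $m,n\ge1$. $\mathcal C^1(S;L_{1,q})$ is the class of differentiable functions whose gradient is Lipschitz on $S$ with constant $L_{1,q}$ (Euclidean norm). *)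

(* Defs.v *)
From HB Require Import structures.
From mathcomp Require Export all_boot all_order all_algebra.
From mathcomp Require Export all_classical all_reals all_analysis.
Export Order.TTheory GRing.Theory Num.Theory.
Export numFieldNormedType.Exports.

Set Implicit Arguments.
Unset Strict Implicit.
Unset Printing Implicit Defensive.

Local Open Scope classical_set_scope.
Local Open Scope ring_scope.

(* The canonical norm of 'rV[R]_k is the sup norm, hence a separate
   definition of the Euclidean one. *)
Definition enorm (R : realType) (k : nat) (z : 'rV[R]_k) : R :=
  Num.sqrt (\sum_(i < k) z ord0 i ^+ 2).

Definition gradient (R : realType) (k : nat) (q : 'rV[R]_k -> R)
    (z : 'rV[R]_k) : 'rV[R]_k :=
  \row_(i < k) 'D_(delta_mx ord0 i) q z.

(* For q : R^(n+m) -> R, the point (x, y) is row_mx x y, and the partial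
   gradients are the first n and the last m coordinates of the gradient. *)
Definition gradient_x (R : realType) (n m : nat) (q : 'rV[R]_(n + m) -> R)
    (x : 'rV[R]_n) (y : 'rV[R]_m) : 'rV[R]_n :=
  lsubmx (gradient q (row_mx x y)).

Definition gradient_y (R : realType) (n m : nat) (q : 'rV[R]_(n + m) -> R)
    (x : 'rV[R]_n) (y : 'rV[R]_m) : 'rV[R]_m :=
  rsubmx (gradient q (row_mx x y)).

Definition C1_lipschitz (R : realType) (k : nat) (S : set 'rV[R]_k) (L : R)
    (q : 'rV[R]_k -> R) : Prop :=
  (forall z, S z -> differentiable q z) /\
  (forall z z', S z -> S z' ->
     enorm (gradient q z - gradient q z') <= L * enorm (z - z')).

Definition zo_gradient_x (R : realType) (n m : nat)
    (q : 'rV[R]_(n + m) -> R) (eta mu : R) (x : 'rV[R]_n) (y : 'rV[R]_m)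
    (u : 'rV[R]_n) (v : 'rV[R]_m) : 'rV[R]_n :=
  ((q (row_mx (x + eta *: u) (y + mu *: v)) - q (row_mx x y)) / eta) *: u.

Definition independent_RV (d d1 d2 : measure_display) (T : measurableType d)
    (T1 : measurableType d1) (T2 : measurableType d2) (R : realType)
    (P : probability T R) (X : T -> T1) (Y : T -> T2) : Prop :=
  forall (A : set T1) (B : set T2), measurable A -> measurable B ->
    P (X @^-1` A `&` Y @^-1` B) = (P (X @^-1` A) * P (Y @^-1` B))%E.

Definition mutually_independent_RV (d d' : measure_display)
    (T : measurableType d) (T' : measurableType d') (R : realType)
    (P : probability T R) (I : finType) (X : I -> T -> T') : Prop :=
  forall (J : {set I}) (B : I -> set T'), (forall i, measurable (B i)) ->
    P (\bigcap_(i in [set` J]) (X i @^-1` B i)) =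
    (\prod_(i in J) P (X i @^-1` B i))%E.

(* Random vectors take values in k.-tuple R, which carries the product
   (Borel) sigma-algebra, whereas 'rV[R]_k has no measurable structure.
   N(0, I_k) is the law of k independent N(0, 1) coordinates. *)
Definition standard_gaussian (d : measure_display) (T : measurableType d)
    (R : realType) (P : probability T R) (k : nat)
    (U : {RV P >-> k.-tuple (measurableTypeR R)}) : Prop :=
  mutually_independent_RV P
    (fun (i : 'I_k) (w : T) => tnth (U w) i : measurableTypeR R) /\
  (forall (i : 'I_k) (B : set (measurableTypeR R)), measurable B ->
     P ((fun w => tnth (U w) i) @^-1` B) = normal_prob (0 : R) 1 B).

Definition row_of_tuple (R : realType) (k : nat) (t : k.-tuple R) : 'rV[R]_k :=
  \row_(i < k) tnth t i.

(* Main.v *)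
Require Import Defs.
From mathcomp Require Import ring lra measurable_realfun.

(** A function with [L]-Lipschitz gradient differs from its linearization by at
    most [L / 2 |h|^2] at distance [|h|] ([descent_lemma]). For the increment
    [h = (eta u, mu v)] this bounds the squared difference quotient pointwise:
    [|zo_gradient_x|^2 <= L^2 (eta^2 |u|^6 + mu^4 / eta^2 |u|^2 |v|^4)
    + 4 <gx, u>^2 |u|^2 + 4 mu^2 / eta^2 |u|^2 <gy, v>^2], with [gx] and [gy] the
    two partial gradients ([zo_gradient_x_sqnorm_le]).

    It remains to take expectations of polynomials in Gaussian vectors. For a
    standard Gaussian vector [u] of dimension [n] and a fixed vector [g],
    [E |u|^2 = n], [E |u|^4 = n (n + 2)], [E |u|^6 = n (n + 2) (n + 4)],
    [E <g, u>^2 = |g|^2] and [E <g, u>^2 |u|^2 = (n + 2) |g|^2]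
    ([gaussian_momentsP]), and the mixed terms factor since [u] and [v] are
    independent ([has_meanM]). The two gradient terms are then exactly those of
    the theorem; the other two follow from [n (n + 2) (n + 4) <= (n + 6)^3] and
    [m (m + 2) <= (m + 4)^2].

    The moments of a Gaussian vector are computed by induction on the dimension,
    splitting off one coordinate, which is independent of the tuple of the others
    ([independent_head_tail]). This needs the moments of orders 1, 2, 3, 4 and 6
    of the standard normal law: the odd ones vanish by symmetry and the even ones
    satisfy [M (k + 2) = (k + 1) M k], by parts. *)

Set Implicit Arguments.
Unset Strict Implicit.
Unset Printing Implicit Defensive.

Local Open Scope classical_set_scope.
Local Open Scope ring_scope.

(** * Expectations *)

(** The integral of a nonnegative function is a supremum over the simple functions
    below it, hence monotone on arbitrary functions; [q] composed with the random
    vectors can thus be compared directly with a polynomial in them. *)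
Lemma ge0_le_integralT_nonmeasurable d (T : measurableType d) (R : realType)
    (mu : {measure set T -> \bar R}) (f g : T -> \bar R) :
  (forall x, 0 <= f x)%E -> (forall x, f x <= g x)%E ->
  (\int[mu]_x f x <= \int[mu]_x g x)%E.
Proof.
move=> f0 fg; rewrite !ge0_integralTE//; last first.
  by move=> x; exact: le_trans (f0 x) (fg x).
apply: ge_ereal_sup => _ [h hf <-]; apply: ereal_sup_ubound; exists h => // x.
exact: le_trans (hf x) (fg x).
Qed.

(** Integrability and value are bundled because linearity of the integral and the
    product rule for independent variables use and propagate both. *)
Definition has_mean d (T : measurableType d) (R : realType)
    (P : {measure set T -> \bar R}) (X : T -> R) (c : R) : Prop :=
  P.-integrable setT (EFin \o X) /\ (\int[P]_w (X w)%:E = c%:E)%E.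

Section has_mean.
Context d (T : measurableType d) (R : realType) (P : {measure set T -> \bar R}).
Implicit Types (X Y : T -> R) (a b c : R).

Lemma has_mean_eq X Y a b : X =1 Y -> a = b -> has_mean P X a -> has_mean P Y b.
Proof. by move=> /funext-> ->. Qed.

Lemma has_meanD X Y a b : has_mean P X a -> has_mean P Y b ->
  has_mean P (fun w => X w + Y w) (a + b).
Proof.
move=> [iX EX] [iY EY]; split; first exact: (integrableD _ iX iY).
under eq_integral do rewrite EFinD.
by rewrite (integralD _ iX iY)// EX EY.
Qed.

Lemma has_meanZ X a c : has_mean P X a -> has_mean P (fun w => c * X w) (c * a).
Proof.
move=> [iX EX]; split; first exact: (integrableZl _ _ iX).
under eq_integral do rewrite EFinM.
by rewrite (integralZl _ iX)// EX.
Qed.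

End has_mean.

Lemma has_mean_cst d (T : measurableType d) (R : realType)
    (P : probability T R) (c : R) : has_mean P (cst c) c.
Proof.
split; first exact: finite_measure_integrable_cst.
transitivity (c%:E * P setT)%E; last by rewrite probability_setT mule1.
exact: (integral_cst P measurableT c%:E).
Qed.

(** Independence says that the joint law is the product of the two laws; Fubini's
    theorem on that product separates the integral. *)
Lemma has_meanM d d1 d2 (T : measurableType d) (T1 : measurableType d1)
    (T2 : measurableType d2) (R : realType) (P : probability T R)
    (X : T -> T1) (Y : T -> T2) (f : T1 -> R) (g : T2 -> R) (a b : R) :
  measurable_fun setT X -> measurable_fun setT Y ->
  measurable_fun setT f -> measurable_fun setT g ->
  independent_RV P X Y -> has_mean P (f \o X) a -> has_mean P (g \o Y) b ->
  has_mean P (fun w => f (X w) * g (Y w)) (a * b).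
Proof.
move=> mX mY mf mg XY [iX EX] [iY EY].
have mXY : measurable_fun setT (fun w => (X w, Y w)).
  exact/measurable_fun_pair.
pose XR : {RV P >-> T1} := mfun_Sub (mem_set mX).
pose YR : {RV P >-> T2} := mfun_Sub (mem_set mY).
pose XYR : {RV P >-> (T1 * T2)%type} := mfun_Sub (mem_set mXY).
pose pX := distribution P XR; pose pY := distribution P YR.
pose law := distribution P XYR.
have lawE : forall A, measurable A -> (pX \x pY)%E A = law A.
  by apply: product_measure_unique => A B mA mB; exact: XY.
have mf' : measurable_fun setT (EFin \o f) by exact/measurable_EFinP.
have mg' : measurable_fun setT (EFin \o g) by exact/measurable_EFinP.
pose h (z : T1 * T2) : \bar R := ((EFin \o f) z.1 * (EFin \o g) z.2)%E.
have mh : measurable_fun setT h.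
  by apply: emeasurable_funM; exact: measurableT_comp.
have finX : (\int[pX]_x `|(EFin \o f) x| < +oo)%E.
  rewrite ge0_integral_distribution//; last exact: measurableT_comp.
  by have /integrableP[] := iX.
have finY : (\int[pY]_x `|(EFin \o g) x| < +oo)%E.
  rewrite ge0_integral_distribution//; last exact: measurableT_comp.
  by have /integrableP[] := iY.
have iX' : pX.-integrable setT (EFin \o f) by exact/integrableP.
have iY' : pY.-integrable setT (EFin \o g) by exact/integrableP.
have EX' : (\int[pX]_x (EFin \o f) x = a%:E)%E by rewrite integral_distribution.
have EY' : (\int[pY]_x (EFin \o g) x = b%:E)%E by rewrite integral_distribution.
have innerE x : (\int[pY]_y `|h (x, y)| =
    `|(EFin \o f) x| * \int[pY]_y `|(EFin \o g) y|)%E.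
  transitivity (\int[pY]_y (`|(EFin \o f) x| * `|(EFin \o g) y|))%E.
    by apply: eq_integral => y _; rewrite -abseM.
  by apply: ge0_integralZl => //; exact: measurableT_comp.
have inth : (pX \x pY)%E.-integrable setT h.
  apply/integrable12ltyP => //.
  under eq_integral do rewrite innerE.
  rewrite ge0_integralZr ?integral_ge0//; last exact: measurableT_comp.
  by rewrite lte_mul_pinfty ?integral_ge0// ge0_fin_numE ?integral_ge0.
have Eh : (\int[pX \x pY]_z h z = (a * b)%:E)%E.
  rewrite -integral12_prod_meas1//.
  transitivity (\int[pX]_x ((EFin \o f) x * b%:E))%E.
    by apply: eq_integral => x _; rewrite /fubini_F -EY' -integralZl.
  by rewrite integralZr// EX' EFinM.
have iXY : P.-integrable setT (h \o XYR).
  apply/integrableP; split; first exact: measurableT_comp.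
  have /integrableP[_] := inth.
  rewrite (eq_measure_integral law); last by move=> A mA _; exact: lawE.
  by rewrite ge0_integral_distribution//; exact: measurableT_comp.
split; first exact: iXY.
rewrite -Eh (eq_measure_integral law); last by move=> A mA _; exact: lawE.
by rewrite integral_distribution.
Qed.

(** * Functions with Lipschitz gradient *)

Lemma enorm_ge0 (R : realType) (k : nat) (z : 'rV[R]_k) : 0 <= enorm z.
Proof. exact: sqrtr_ge0. Qed.

Lemma enorm_sqr (R : realType) (k : nat) (z : 'rV[R]_k) :
  enorm z ^+ 2 = \sum_(i < k) z ord0 i ^+ 2.
Proof. by rewrite sqr_sqrtr// sumr_ge0// => i _; exact: sqr_ge0. Qed.

Lemma enormZ (R : realType) (k : nat) (a : R) (z : 'rV[R]_k) :
  enorm (a *: z) = `|a| * enorm z.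
Proof.
rewrite /enorm -sqrtr_sqr -sqrtrM ?sqr_ge0//; congr Num.sqrt.
by rewrite mulr_sumr; apply: eq_bigr => i _; rewrite mxE exprMn.
Qed.

(** Lagrange's identity: the defect is half of the double sum of the squares
    [(a i * b j - a j * b i) ^+ 2]. *)
Lemma cauchy_schwarz_sqr (R : realType) (k : nat) (a b : 'I_k -> R) :
  (\sum_i a i * b i) ^+ 2 <= (\sum_i a i ^+ 2) * (\sum_i b i ^+ 2).
Proof.
suff : 0 <= \sum_i \sum_j (a i * b j - a j * b i) ^+ 2.
  rewrite (_ : \sum_i \sum_j _ =
     2 * ((\sum_i a i ^+ 2) * (\sum_i b i ^+ 2) - (\sum_i a i * b i) ^+ 2)).
    by rewrite pmulr_rge0// subr_ge0.
  have sumM (f g : 'I_k -> R) :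
      \sum_i \sum_j f i * g j = (\sum_i f i) * (\sum_j g j).
    by rewrite mulr_suml; apply: eq_bigr => i _; rewrite mulr_sumr.
  transitivity (\sum_i \sum_j a i ^+ 2 * b j ^+ 2
     + \sum_i \sum_j b i ^+ 2 * a j ^+ 2
     - 2 * \sum_i \sum_j (a i * b i) * (a j * b j)).
    rewrite mulr_sumr -big_split/= -sumrB; apply: eq_bigr => i _.
    rewrite mulr_sumr -big_split/= -sumrB; apply: eq_bigr => j _.
    by ring.
  by rewrite !sumM; ring.
by apply: sumr_ge0 => i _; apply: sumr_ge0 => j _; exact: sqr_ge0.
Qed.

Lemma cauchy_schwarz_enorm (R : realType) (k : nat) (a b : 'rV[R]_k) :
  \sum_i a ord0 i * b ord0 i <= enorm a * enorm b.
Proof.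
apply: le_trans (ler_norm _) _; rewrite -sqrtr_sqr -sqrtrM.
  by apply: ler_wsqrtr; exact: cauchy_schwarz_sqr.
by apply: sumr_ge0 => i _; exact: sqr_ge0.
Qed.

Lemma diff_gradient (R : realType) (k : nat) (q : 'rV[R]_k -> R)
    (z h : 'rV[R]_k) : differentiable q z ->
  'd q z h = \sum_i gradient q z ord0 i * h ord0 i.
Proof.
move=> dq; rewrite [in LHS](row_sum_delta h) linear_sum; apply: eq_bigr => i _.
by rewrite linearZ/= mxE deriveE// mulrC.
Qed.

Lemma is_derive_line (R : realType) (k : nat) (q : 'rV[R]_k -> R)
    (z h : 'rV[R]_k) (t : R) : differentiable q (z + t *: h) ->
  is_derive t (1 : R) (fun s : R => q (z + s *: h))
    (\sum_i gradient q (z + t *: h) ord0 i * h ord0 i).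
Proof.
move=> dq; have lineE :
    (fun s : R => s^-1 *: (((fun r : R => q (z + r *: h)) \o shift t) (s *: 1)
      - q (z + t *: h))) =
    (fun s : R => s^-1 *: ((q \o shift (z + t *: h)) (s *: h)
      - q (z + t *: h))).
  apply/funext => s /=; congr (_ *: (q _ - _)).
  by rewrite [s *: 1]mulr1 scalerDl addrCA addrA addrC addrA.
have dh : derivable q (z + t *: h) h by exact: diff_derivable.
apply: DeriveDef; first by rewrite /derivable lineE.
by rewrite -diff_gradient// -deriveE// /derive lineE.
Qed.

(** Along the segment, the derivative of
    [t |-> q (z + t h) - t <grad q z, h> - L / 2 |h|^2 t^2] is
    [<grad q (z + t h) - grad q z, h> - L |h|^2 t], which is nonpositive by
    Cauchy-Schwarz and the Lipschitz bound; the mean value theorem then compares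
    the values at 0 and 1. *)
Lemma descent_upper (R : realType) (k : nat) (L : R) (q : 'rV[R]_k -> R)
    (z h : 'rV[R]_k) : C1_lipschitz setT L q ->
  q (z + h) - q z - \sum_i gradient q z ord0 i * h ord0 i
    <= L / 2 * enorm h ^+ 2.
Proof.
move=> [dq lipq]; set g := \sum_i _.
pose psi' (t : R) := \sum_i gradient q (z + t *: h) ord0 i * h ord0 i - g
   - L * enorm h ^+ 2 * t.
pose psi (t : R) := q (z + t *: h) - g * t - L / 2 * enorm h ^+ 2 * t ^+ 2.
have dpsi (t : R) : is_derive t (1 : R) psi (psi' t).
  have dqt := is_derive_line (dq (z + t *: h) I).
  rewrite /psi; apply: is_derive_eq.
  rewrite /psi' /GRing.scale/=; by field.
have psi'_le0 t : 0 <= t -> psi' t <= 0.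
  move=> t0; rewrite /psi' subr_le0.
  rewrite (_ : _ - g = \sum_i (gradient q (z + t *: h) - gradient q z) ord0 i
      * h ord0 i); last first.
    by rewrite -sumrB; apply: eq_bigr => i _; rewrite !mxE mulrBl.
  apply: (le_trans (cauchy_schwarz_enorm _ _)).
  have := lipq (z + t *: h) z I I.
  rewrite addrAC subrr add0r enormZ ger0_norm// => lip.
  apply: (le_trans (ler_wpM2r (enorm_ge0 h) lip)).
  by rewrite le_eqVlt; apply/orP; left; apply/eqP; ring.
have cpsi : {within `[0, 1], continuous psi}.
  apply: continuous_subspaceT => t; apply: differentiable_continuous.
  by apply/derivable1_diffP; have [] := dpsi t.
have [c] := MVT_segment ler01 (fun t _ => dpsi t) cpsi.
rewrite in_itv/= subr0 mulr1 => /andP[c0 _] psi10.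
have : psi 1 - psi 0 <= 0 by rewrite psi10 psi'_le0.
rewrite /psi scale1r scale0r addr0; lra.
Qed.

Lemma C1_lipschitzN (R : realType) (k : nat) (S : set 'rV[R]_k) (L : R)
    (q : 'rV[R]_k -> R) : C1_lipschitz S L q -> C1_lipschitz S L (\- q).
Proof.
move=> [dq lipq]; split=> [z Sz|z z' Sz Sz']; first exact/differentiableN/dq.
have gN w : S w -> gradient (\- q) w = - gradient q w.
  move=> Sw; apply/rowP => i; rewrite !mxE deriveN//.
  exact/diff_derivable/dq.
rewrite !gN// -opprD -[X in enorm X]scaleN1r enormZ normrN1 mul1r.
exact: lipq.
Qed.

(** The lower bound is the upper one for [\- q]. *)
Lemma descent_lemma (R : realType) (k : nat) (L : R) (q : 'rV[R]_k -> R)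
    (z h : 'rV[R]_k) : C1_lipschitz setT L q ->
  `|q (z + h) - q z - \sum_i gradient q z ord0 i * h ord0 i|
    <= L / 2 * enorm h ^+ 2.
Proof.
move=> hq; rewrite ler_norml descent_upper// andbT.
have := descent_upper z h (C1_lipschitzN hq).
rewrite (_ : \sum_i gradient (\- q) z ord0 i * h ord0 i =
   - \sum_i gradient q z ord0 i * h ord0 i); first by rewrite /=; lra.
rewrite -sumrN; apply: eq_bigr => i _; rewrite !mxE deriveN ?mulNr//.
exact/diff_derivable/(hq.1 z I).
Qed.

(** * Moments of the standard normal law *)

(** By uniqueness of the Radon-Nikodym derivative, the one of the normal law
    agrees almost everywhere with [normal_pdf]. *)
Lemma ge0_integral_normal_prob (R : realType) (m s : R) (f : R -> \bar R) :
  (forall x, 0 <= f x)%E -> measurable_fun setT f ->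
  (\int[normal_prob m s]_x f x =
   \int[lebesgue_measure]_x (f x * (normal_pdf m s x)%:E))%E.
Proof.
move=> f0 mf; have dom := normal_prob_dominates m s.
have mpdf : measurable_fun setT (EFin \o normal_pdf m s).
  by apply/measurable_EFinP; exact: measurable_normal_pdf.
have irn := Radon_Nikodym_SigmaFinite.f_integrable dom.
rewrite -(Radon_Nikodym_SigmaFinite.change_of_variables dom)//.
apply: ae_eq_integral => //.
- by apply: emeasurable_funM => //; exact: measurable_int irn.
- exact: emeasurable_funM.
apply: ae_eqe_mul2l; apply: integral_ae_eq => //= A _ mA.
by rewrite -(Radon_Nikodym_SigmaFinite.f_integral dom).
Qed.

Section std_normal.
Context {R : realType}.
Notation mu := (@lebesgue_measure R).
Let p : R -> R := normal_pdf 0 1.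

Let pE x : p x = normal_peak 1 * expR (- (x ^+ 2 / 2)).
Proof.
by rewrite /p normal_pdfE ?oner_neq0// /normal_fun subr0 expr1n mulNr.
Qed.

Let is_derive_p (x : R) : is_derive x 1 p (- (x * p x)).
Proof.
rewrite (_ : p = fun y : R => normal_peak 1 * expR (- (y ^+ 2 / 2)));
  last exact/funext.
apply: is_derive_eq; rewrite /GRing.scale/=; by field.
Qed.

(** The exponential series bounds [expR (n^2 / 2)] below by a multiple of
    [n^(2k+2)], hence [n^k p n] above by a multiple of [1 / n]. *)
Let Xp_cvg0 (k : nat) : (n%:R ^+ k * p n%:R) @[n --> \oo] --> 0.
Proof.
pose C : R := normal_peak 1 * (k.+1`!%:R * 2 ^+ k.+1).
apply: (@squeeze_cvgr _ _ _ _ (fun=> 0) (fun n => C * (n.+1%:R^-1 * 2))).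
- near=> n.
  have n0 : (0 : R) < n%:R by rewrite ltr0n; near: n; exact: nbhs_infty_gt.
  rewrite pE; apply/andP; split.
    by rewrite !mulr_ge0 ?exprn_ge0 ?normal_peak_ge0 ?expR_ge0 ?ltW.
  rewrite mulrCA /C -[leRHS]mulrA ler_wpM2l ?normal_peak_ge0//.
  rewrite expRN ler_pdivrMr ?expR_gt0//.
  set E := expR _; set F : R := k.+1`!%:R.
  have F0 : 0 < F by rewrite ltr0n fact_gt0.
  have n1 : (1 : R) <= n%:R by rewrite ler1n; near: n; exact: nbhs_infty_ge.
  have powE : n%:R ^+ k.+1 * n%:R ^+ k.+1 <= F * 2 ^+ k.+1 * E.
    have : 1 + (n%:R ^+ 2 / 2) ^+ k.+1 / F <= E.
      by apply: expR_ge1Dxn; rewrite divr_ge0// sqr_ge0.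
    rewrite expr_div_n -exprM mulnC exprM => EF.
    have {EF} : (n%:R ^+ k.+1) ^+ 2 / 2 ^+ k.+1 / F <= E.
      by apply: le_trans EF; rewrite lerDr.
    by rewrite ler_pdivrMr// ler_pdivrMr ?exprn_gt0// expr2 => /le_trans; apply;
      rewrite mulrAC mulrC mulrA [leRHS]mulrAC.
  have n2 : n.+1%:R <= 2 * n%:R :> R by rewrite -addn1 natrD; lra.
  rewrite (_ : _ * (n.+1%:R^-1 * 2) * E = F * 2 ^+ k.+1 * E * 2 / n.+1%:R);
    last by ring.
  rewrite ler_pdivlMr ?ltr0n//.
  apply: le_trans (ler_wpM2r _ powE); last by [].
  apply: le_trans (ler_wpM2l _ n2) _; first by rewrite exprn_ge0// ltW.
  rewrite mulrCA -exprSr mulrC ler_wpM2r// ler_peMr ?exprn_ge0 ?(ltW n0)//.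
  exact: exprn_ege1.
- exact: cvg_cst.
- rewrite -[X in _ --> X](mulr0 C); apply: cvgMr.
  by rewrite -[X in _ --> X](mul0r 2); apply: cvgMl; exact: cvg_harmonic.
Unshelve. all: end_near. Qed.

Let cont_Xp (k : nat) : continuous (fun x : R => x ^+ k * p x).
Proof.
move=> x; apply: cvgM; first exact: exprn_continuous.
by apply: continuous_normal_pdf; exact: oner_neq0.
Qed.

Let half_moment (k : nat) : \bar R :=
  (\int[mu]_(x in `[0%R, +oo[) (x ^+ k * p x)%:E)%E.

Let trunc_moment (k n : nat) : \bar R :=
  (\int[mu]_(x in `[0%R, n%:R]) (x ^+ k * p x)%:E)%E.

Let integrable_Xp (k n : nat) :
  mu.-integrable `[0, n%:R] (fun x => (x ^+ k * p x)%:E).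
Proof.
apply: continuous_compact_integrable; first exact: segment_compact.
exact: continuous_subspaceT.
Qed.

Let trunc_moment_fin (k n : nat) : trunc_moment k n \is a fin_num.
Proof. by apply: integrable_fin_num => //; exact: integrable_Xp. Qed.

(** Integration by parts with the primitive [- p x] of [x * p x]. *)
Let trunc_moment_parts (k n : nat) : (0 < n)%N ->
  (trunc_moment k.+2 n + (n%:R ^+ k.+1 * p n%:R)%:E =
   (k.+1%:R)%:E * trunc_moment k n)%E.
Proof.
move=> n0; have n0' : (0 : R) < n%:R by rewrite ltr0n.
have dF (x : R) : is_derive x 1 (fun y => - p y) (x * p x).
  rewrite -[x * p x]opprK; exact: is_deriveN.
have dG (x : R) : is_derive x 1 (fun y : R => y ^+ k.+1) (k.+1%:R * x ^+ k).
  apply: DeriveDef; first exact: exprn_derivable.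
  by rewrite exp_derive/= /GRing.scale/= mulr1.
have LRcont (f f' : R -> R) : (forall x : R, is_derive x 1 f (f' x)) ->
    derivable_oo_LRcontinuous f 0 n%:R.
  move=> df; have cf : continuous f.
    move=> x; apply/differentiable_continuous/derivable1_diffP.
    by have [] := df x.
  by split=> [x _||]; [have [] := df x|
     apply: cvg_at_right_filter; exact: cf|apply: cvg_at_left_filter; exact: cf].
have F'E (f f' : R -> R) : (forall x : R, is_derive x 1 f (f' x)) ->
    {in `]0, n%:R[, f^`()%classic =1 f'}.
  by move=> df x _; rewrite derive1E; have [] := df x.
have := @integration_by_parts R (fun y => - p y) (fun y => y ^+ k.+1)
  (fun x => x * p x) (fun x => k.+1%:R * x ^+ k) 0 n%:R n0'
  _ (LRcont _ _ dF) (F'E _ _ dF) _ (LRcont _ _ dG) (F'E _ _ dG).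
rewrite expr0n/= mulr0 subr0.
rewrite (_ : integral _ _ _ = (- k.+1%:R)%:E * trunc_moment k n)%E; last first.
  rewrite -(integralZl _ (integrable_Xp k n))//.
  by apply: eq_integral => x _; rewrite -EFinM; congr EFin; ring.
rewrite [X in _ -> _ -> _ = (_ - X)%E](_ : _ = trunc_moment k.+2 n); last first.
  by apply: eq_integral => x _; congr EFin; rewrite !exprS; ring.
have c1 : {within `[0, n%:R], continuous (fun x : R => x * p x)}.
  apply: continuous_subspaceT => x; apply: cvgM; first exact: cvg_id.
  by apply: continuous_normal_pdf; exact: oner_neq0.
have c2 : {within `[0, n%:R], continuous (fun x : R => k.+1%:R * x ^+ k)}.
  apply: continuous_subspaceT => x; apply: cvgM; first exact: cvg_cst.
  exact: exprn_continuous.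
rewrite -(fineK (trunc_moment_fin k n)) -(fineK (trunc_moment_fin k.+2 n)).
move=> /(_ c1 c2).
rewrite -!EFinM -EFinB => -[parts]; congr EFin.
by apply: oppr_inj; rewrite -mulNr parts; ring.
Qed.

Let cvg_trunc_moment (k : nat) : trunc_moment k n @[n --> \oo] --> half_moment k.
Proof.
have mf : measurable_fun setT (fun x : R => x ^+ k * p x).
  by apply: continuous_measurable_fun; exact: cont_Xp.
have -> : half_moment k = (\int[mu]_(x in `[0%R, +oo[) (`|x ^+ k * p x|)%:E)%E.
  apply: eq_integral => x; rewrite inE/= in_itv/= andbT => x0.
  by rewrite ger0_norm// mulr_ge0 ?exprn_ge0 ?normal_pdf_ge0.
rewrite (_ : trunc_moment k = fun n =>
    \int[mu]_(x in `[0%R, n%:R]) (`|x ^+ k * p x|)%:E)%E.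
  by apply: ge0_cvgn_integral => //; exact: measurableT_comp.
apply/funext => n; apply: eq_integral => x.
rewrite inE/= in_itv/= => /andP[x0 _].
by rewrite ger0_norm// mulr_ge0 ?exprn_ge0 ?normal_pdf_ge0.
Qed.

(** The identity of [trunc_moment_parts] in the limit, where the boundary term
    vanishes. *)
Let half_moment_rec (k : nat) :
  half_moment k.+2 = ((k.+1%:R)%:E * half_moment k)%E.
Proof.
have cvgl : (trunc_moment k.+2 n + (n%:R ^+ k.+1 * p n%:R)%:E)%E @[n --> \oo]
    --> (half_moment k.+2 + 0%:E)%E.
  apply: cvgeD; [by rewrite fin_num_adde_defl|exact: cvg_trunc_moment|].
  by apply/cvg_EFin => //; [exact: nearW|exact: Xp_cvg0].
have cvgr : ((k.+1%:R)%:E * trunc_moment k n)%E @[n --> \oo]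
    --> ((k.+1%:R)%:E * half_moment k)%E.
  by apply: cvgeZl => //; exact: cvg_trunc_moment.
rewrite adde0 in cvgl; apply: cvg_unique cvgl _ => //.
apply: cvg_trans cvgr; apply: near_eq_cvg; near=> n.
by apply/esym/trunc_moment_parts; near: n; exact: nbhs_infty_gt.
Unshelve. all: end_near. Qed.

Let even_moment_half (k : nat) : ~~ odd k ->
  (\int[normal_prob 0 1]_x (x ^+ k)%:E = 2%:E * half_moment k)%E.
Proof.
move=> evk.
have Xk0 (x : R) : 0 <= x ^+ k by rewrite exprn_even_ge0.
rewrite ge0_integral_normal_prob; last 2 first.
  by move=> x; rewrite lee_fin.
  by apply/measurable_EFinP; exact: measurable_funX.
under eq_integral do rewrite -EFinM.
rewrite ge0_symfun_integralT.
- by rewrite -set_itvcy.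
- by move=> x; rewrite mulr_ge0// normal_pdf_ge0.
- exact: cont_Xp.
- move=> x /=; rewrite -/p !pE sqrrN exprNn -signr_odd (negbTE evk) expr0.
  by rewrite mul1r.
Qed.

Lemma normal_even_moment_rec (k : nat) : ~~ odd k ->
  (\int[normal_prob 0 1]_x (x ^+ k.+2)%:E =
   (k.+1%:R)%:E * \int[normal_prob 0 1]_x (x ^+ k)%:E :> \bar R)%E.
Proof.
by move=> ek; rewrite !even_moment_half//= ?negbK// half_moment_rec muleCA.
Qed.

End std_normal.

Lemma normal_probN (R : realType) (A : set (measurableTypeR R)) :
  measurable A -> normal_prob (0 : R) 1 (-%R @^-1` A) = normal_prob 0 1 A.
Proof.
move=> mA.
have evenp (x : R) : normal_pdf 0 1 (- x) = normal_pdf 0 1 x.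
  by rewrite !normal_pdfE ?oner_neq0// /normal_fun !subr0 sqrrN.
have mp : measurable_fun setT (EFin \o @normal_pdf R 0 1).
  by apply/measurable_EFinP; exact: measurable_normal_pdf.
rewrite /normal_prob.
under eq_integral do rewrite -evenp.
pose opp : measurableTypeR R -> measurableTypeR R := -%R.
have mopp : measurable_fun setT opp by exact: oppr_measurable.
transitivity (\int[lebesgue_measure]_(x in opp @^-1` A)
  ((EFin \o @normal_pdf R 0 1) \o opp) x)%E; first by [].
rewrite -ge0_integral_pushforward//=.
- by apply: eq_measure_integral => //= B mB _; exact: lebesgue_measureN.
- exact: measurable_funS mp.
- by move=> x _; rewrite lee_fin normal_pdf_ge0.
Qed.

Lemma normal_moment0 (R : realType) :
  has_mean (normal_prob (0 : R) 1) (fun x : R => x ^+ 0) 1.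
Proof. by apply: has_mean_eq (has_mean_cst (normal_prob (0 : R) 1) 1). Qed.

(** The integral recurrence propagates finiteness, hence integrability, from one
    even power to the next. *)
Lemma normal_even_moment (R : realType) (k : nat) (c : R) : ~~ odd k ->
  has_mean (normal_prob (0 : R) 1) (fun x : R => x ^+ k) c ->
  has_mean (normal_prob (0 : R) 1) (fun x : R => x ^+ k.+2) (k.+1%:R * c).
Proof.
move=> ek [_ Ek].
have E2 := @normal_even_moment_rec R _ ek.
rewrite Ek -EFinM in E2.
split; last exact: E2.
apply/integrableP; split; first by apply/measurable_EFinP; exact: measurable_funX.
under eq_integral => x _ do
  rewrite /= ger0_norm ?exprn_even_ge0//= ?negbK//.
by rewrite E2 ltry.
Qed.

(** [|x|^k <= 1 + x^(k+1)] gives integrability. The normal law is invariant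
    under [x |-> - x], which changes the sign of the integral; so it is 0. *)
Lemma normal_odd_moment (R : realType) (k : nat) (c : R) : odd k ->
  has_mean (normal_prob (0 : R) 1) (fun x : R => x ^+ k.+1) c ->
  has_mean (normal_prob (0 : R) 1) (fun x : R => x ^+ k) 0.
Proof.
move=> ok hk1.
have mX : measurable_fun setT (fun x : R => (x ^+ k)%:E).
  by apply/measurable_EFinP; exact: measurable_funX.
have iX : (normal_prob (0 : R) 1).-integrable setT (fun x : R => (x ^+ k)%:E).
  have [i1 _] := has_meanD (has_mean_cst (normal_prob (0 : R) 1) 1) hk1.
  apply: le_integrable i1 => // x _ /=; rewrite lee_fin.
  have Xk1 : x ^+ k.+1 = `|x| ^+ k.+1.
    by rewrite -normrX ger0_norm// exprn_even_ge0//= ok.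
  rewrite [leRHS]ger0_norm; last by rewrite Xk1 addr_ge0// exprn_ge0.
  rewrite normrX Xk1; have [x1|x1] := leP `|x| 1.
    by apply: ler_wpDr; [exact: exprn_ge0|exact: exprn_ile1].
  by apply: ler_wpDl => //; rewrite ler_eXn2l.
split; first exact: iX.
pose opp : measurableTypeR R -> measurableTypeR R := -%R.
have mopp : measurable_fun setT opp by exact: oppr_measurable.
have sym : (\int[normal_prob (0 : R) 1]_x (x ^+ k)%:E =
    - \int[normal_prob (0 : R) 1]_x (x ^+ k)%:E)%E.
  transitivity (\int[pushforward (normal_prob (0 : R) 1) opp]_x (x ^+ k)%:E)%E.
    apply: eq_measure_integral => B mB _.
    exact/esym/normal_probN.
  rewrite integral_pushforward//=.
    rewrite preimage_setT -integralN//; last exact: integrable_add_def.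
    apply: eq_integral => x _ /=.
    by rewrite /opp exprNn -signr_odd ok expr1 mulN1r EFinN.
  apply/integrableP; split; first exact: measurableT_comp.
  have /integrableP[_] := iX; congr (_ < _)%E; apply: eq_integral => x _ /=.
  by rewrite /opp !normrX normrN.
have [r Ir] : exists r, (\int[normal_prob (0 : R) 1]_x (x ^+ k)%:E = r%:E)%E.
  exists (fine (\int[normal_prob (0 : R) 1]_x (x ^+ k)%:E)).
  by rewrite fineK// integrable_fin_num.
by move: sym; rewrite Ir => -[?]; congr EFin; lra.
Qed.

Lemma has_mean_law d (T : measurableType d) (R : realType) (P : probability T R)
    (x : T -> R) (f : R -> R) (c : R) :
  measurable_fun setT x ->
  (forall B : set (measurableTypeR R), measurable B ->
    P (x @^-1` B) = normal_prob (0 : R) 1 B) ->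
  measurable_fun setT f -> has_mean (normal_prob (0 : R) 1) f c ->
  has_mean P (f \o x) c.
Proof.
move=> mx lawx mf [intf Ef].
have mf' : measurable_fun setT (EFin \o f) by exact/measurable_EFinP.
pose x' : T -> measurableTypeR R := x.
have mx' : measurable_fun setT x' by exact: mx.
have lawE (g : measurableTypeR R -> \bar R) :
    (\int[pushforward P x']_r g r = \int[normal_prob (0 : R) 1]_r g r)%E.
  by apply: eq_measure_integral => B mB _; exact: lawx.
have ifx : P.-integrable setT ((EFin \o f) \o x').
  apply/integrableP; split; first exact: measurableT_comp.
  have /integrableP[_] := intf; rewrite -lawE.
  by rewrite ge0_integral_pushforward//; exact: measurableT_comp.
split; first exact: ifx.
by rewrite -Ef -lawE integral_pushforward.
Qed.

Definition normal_moments d (T : measurableType d) (R : realType)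
    (P : probability T R) (x : T -> R) : Prop :=
  [/\ has_mean P x 0, has_mean P (fun w => x w ^+ 2) 1,
     has_mean P (fun w => x w ^+ 3) 0, has_mean P (fun w => x w ^+ 4) 3 &
     has_mean P (fun w => x w ^+ 6) 15].

Lemma normal_momentsP d (T : measurableType d) (R : realType)
    (P : probability T R) (x : T -> R) :
  measurable_fun setT x ->
  (forall B : set (measurableTypeR R), measurable B ->
    P (x @^-1` B) = normal_prob (0 : R) 1 B) ->
  normal_moments P x.
Proof.
move=> mx lawx.
have law k c : has_mean (normal_prob (0 : R) 1) (fun x : R => x ^+ k) c ->
    has_mean P (fun w => x w ^+ k) c.
  by apply: has_mean_law => //; exact: measurable_funX.
have m0 := normal_moment0 R.
have m2 := @normal_even_moment R 0 _ isT m0.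
have m4 := @normal_even_moment R 2 _ isT m2.
have m6 := @normal_even_moment R 4 _ isT m4.
have m1 := @normal_odd_moment R 1 _ isT m2.
have m3 := @normal_odd_moment R 3 _ isT m4.
split; first exact: (law 1).
- by apply: has_mean_eq (law _ _ m2) => //; rewrite mulr1.
- exact: law.
- by apply: has_mean_eq (law _ _ m4) => //; ring.
- by apply: has_mean_eq (law _ _ m6) => //; ring.
Qed.

(** * Independence of the coordinates of a random tuple *)

Section boxes.
Context d (T : measurableType d) (n : nat).

Definition box (B : 'I_n -> set T) : set (n.-tuple T) :=
  [set t | forall i, B i (tnth t i)].

Definition measurable_boxes : set (set (n.-tuple T)) :=
  [set A | exists2 B, (forall i, measurable (B i)) & A = box B].

Lemma measurable_boxes_setI_closed : setI_closed measurable_boxes.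
Proof.
move=> _ _ [A mA ->] [B mB ->]; exists (fun i => A i `&` B i).
  by move=> i; exact: measurableI.
apply/seteqP; split=> [t [At Bt] i|t ABt]; first by split.
by split=> i; have [] := ABt i.
Qed.

Lemma measurable_boxesT : measurable_boxes setT.
Proof. by exists (fun=> setT) => //; apply/seteqP; split. Qed.

(** The sigma-algebra on tuples is defined by the coordinate cylinders, which are
    not stable under intersection; boxes are, and this makes uniqueness of
    measures applicable. *)
Lemma measurable_tuple_boxes :
  @measurable _ (n.-tuple T) = <<s measurable_boxes >>.
Proof.
apply/seteqP; split.
  apply: smallest_sub; first exact: smallest_sigma_algebra.
  rewrite -bigcup_seq; apply: bigcup_sub => i _ _ [B mB <-].
  apply: sub_sigma_algebra; exists (fun j => if j == i then B else setT).
    by move=> j; case: ifP.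
  apply/seteqP; split=> [t [_ /= Bt] j|t /(_ i)]; last by rewrite eqxx.
  by case: eqP => [->|].
apply: smallest_sub; first exact: sigma_algebra_measurable.
move=> _ [B mB ->].
rewrite (_ : box B = \big[setI/setT]_(i < n) ((@tnth n T)^~ i @^-1` B i)).
  apply: bigsetI_measurable => i _; rewrite -[X in measurable X]setTI.
  exact: measurable_tnth.
apply/seteqP; split => t.
  by move=> Bt; rewrite -bigcap_seq => i _; exact: Bt.
by rewrite -bigcap_seq => Bt i; apply: Bt; rewrite /= mem_index_enum.
Qed.

End boxes.

Lemma measurable_mktuple d d' (T : measurableType d) (T' : measurableType d')
    (n : nat) (X : 'I_n -> T -> T') : (forall i, measurable_fun setT (X i)) ->
  measurable_fun setT (fun w => [tuple X i w | i < n]).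
Proof.
move=> mX; apply/measurable_fun_tnthP => i.
rewrite (_ : _ \o _ = X i)//.
by apply/funext => w /=; rewrite tnth_mktuple.
Qed.

(** For a fixed event on the head, both sides are finite measures of the event on
    the tail. They agree on boxes by mutual independence of the coordinates,
    hence everywhere by uniqueness of measures on a generating pi-system. *)
Lemma independent_head_tail d d' (T : measurableType d) (T' : measurableType d')
    (R : realType) (P : probability T R) (n : nat) (X : 'I_n.+1 -> T -> T') :
  (forall i, measurable_fun setT (X i)) -> mutually_independent_RV P X ->
  independent_RV P (fun w => [tuple X (lift ord0 i) w | i < n]) (X ord0).
Proof.
move=> mX indX A B0 mA mB0; set W := fun w => _.
have mXB i (B : set T') : measurable B -> measurable (X i @^-1` B).
  by move=> mB; rewrite -[X in measurable X]setTI; exact: mX.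
have mW : measurable_fun setT W by exact: measurable_mktuple.
have indXT (B : 'I_n.+1 -> set T') : (forall i, measurable (B i)) ->
    P [set w | forall i, B i (X i w)] = (\prod_i P (X i @^-1` B i))%E.
  move=> mB; have := indX [set: 'I_n.+1]%SET B mB.
  under [X in _ = X -> _]eq_bigl do rewrite inE.
  move=> <-; congr (P _).
  by apply/seteqP; split=> [w Bw i _|w Bw i]; apply: Bw; rewrite /= inE.
have P0_ge0 : 0 <= fine (P (X ord0 @^-1` B0)) by exact/fine_ge0/measure_ge0.
pose c : {nonneg R} := NngNum P0_ge0.
have cE : c%:num%:E = P (X ord0 @^-1` B0).
  by rewrite /= fineK// fin_num_measure//; exact: mXB.
pose WR : {RV P >-> n.-tuple T'} := mfun_Sub (mem_set mW).
have [m1 m1E] : exists m : {measure set (n.-tuple T') -> \bar R},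
    forall C, m C = P (WR @^-1` C `&` X ord0 @^-1` B0).
  by unshelve eexists (pushforward (mrestr P (mXB ord0 B0 mB0)) WR).
pose m2 : {measure set (n.-tuple T') -> \bar R} := mscale c (distribution P WR).
rewrite muleC -cE.
suff : m1 A = m2 A by rewrite m1E.
apply: (measure_unique (@measurable_boxes _ T' n) (fun=> setT)) => //.
- exact: measurable_tuple_boxes.
- exact: measurable_boxes_setI_closed.
- by move=> _; exact: measurable_boxesT.
- by rewrite bigcup_const.
- move=> _ [B mB ->].
  (* the box with [D] in the head coordinate and [B] in the others *)
  pose B' (D : set T') (i : 'I_n.+1) := oapp B D (unlift ord0 i).
  have mB' D : measurable D -> forall i, measurable (B' D i).
    by move=> mD i; rewrite /B'; case: unliftP => [j|] _ /=.
  have B'E D : [set w | forall i, B' D i (X i w)] =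
      WR @^-1` (box B) `&` X ord0 @^-1` D.
    apply/seteqP; split=> [w Bw|w [Bw Dw] i].
      split=> [i|]; last by have := Bw ord0; rewrite /B' unlift_none.
      by have := Bw (lift ord0 i); rewrite /B' liftK/= tnth_mktuple.
    rewrite /B'; case: unliftP => [j|] -> //=.
    by have := Bw j; rewrite /= tnth_mktuple.
  have PB' D : measurable D -> P (WR @^-1` (box B) `&` X ord0 @^-1` D) =
      (P (X ord0 @^-1` D) * \prod_i P (X (lift ord0 i) @^-1` B i))%E.
    move=> mD; rewrite -B'E indXT; last exact: mB'.
    rewrite big_ord_recl /B' unlift_none/=; congr (_ * _)%E.
    by apply: eq_bigr => i _; rewrite liftK.
  rewrite m1E /m2 /= /mscale cE PB'//.
  (* a full head coordinate leaves the tail alone *)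
  have := PB' setT measurableT; rewrite preimage_setT setIT probability_setT.
  by rewrite mul1e => <-.
- move=> _; rewrite m1E; apply: (@le_lt_trans _ _ 1%E); last exact: ltry.
  by rewrite preimage_setT setTI; exact/probability_le1/mXB.
Qed.

Lemma mutually_independent_tail d d' (T : measurableType d)
    (T' : measurableType d') (R : realType) (P : probability T R) (n : nat)
    (X : 'I_n.+1 -> T -> T') :
  mutually_independent_RV P X ->
  mutually_independent_RV P (fun i => X (lift ord0 i)).
Proof.
move=> indX J B mB.
pose B' (i : 'I_n.+1) := oapp B setT (unlift ord0 i).
have mB' i : measurable (B' i) by rewrite /B'; case: unliftP => [j|] _ /=.
have B'E i : B' (lift ord0 i) = B i by rewrite /B' liftK.
have := indX (lift ord0 @: J)%SET B' mB'.
rewrite big_imset/=; last by move=> i j _ _; exact: lift_inj.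
under eq_bigr do rewrite B'E.
move=> <-; congr (P _); apply/seteqP; split=> w Bw i /=.
  by move=> /imsetP[j jJ ->]; rewrite B'E; exact: Bw.
by move=> iJ; rewrite -B'E; apply: Bw => /=; exact: imset_f.
Qed.

(** * Moments of standard Gaussian vectors *)

Definition sqnorm (R : realType) (k : nat) (t : k.-tuple R) : R :=
  \sum_i tnth t i ^+ 2.

Definition dot (R : realType) (k : nat) (g : 'I_k -> R) (t : k.-tuple R) : R :=
  \sum_i g i * tnth t i.

Lemma measurable_sqnorm (R : realType) (k : nat) :
  measurable_fun setT (@sqnorm R k : k.-tuple (measurableTypeR R) -> R).
Proof.
apply: measurable_sum => i; apply: measurable_funX.
exact: (@measurable_tnth _ (measurableTypeR R) k i).
Qed.

Lemma measurable_dot (R : realType) (k : nat) (g : 'I_k -> R) :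
  measurable_fun setT (dot g : k.-tuple (measurableTypeR R) -> R).
Proof.
apply: measurable_sum => i; apply: measurable_funM => //.
exact: (@measurable_tnth _ (measurableTypeR R) k i).
Qed.

(** The two moments of degree 1 in [dot g] occur in the cross terms when one
    coordinate is added; with them, the list is stable under that step. *)
Record gaussian_moments d (T : measurableType d) (R : realType)
    (P : probability T R) (k : nat) (X : T -> k.-tuple R) (g : 'I_k -> R) :
    Prop := GaussianMoments {
  mean_sqnorm : has_mean P (fun w => sqnorm (X w)) k%:R;
  mean_sqnorm2 : has_mean P (fun w => sqnorm (X w) ^+ 2) (k%:R * (k%:R + 2));
  mean_sqnorm3 : has_mean P (fun w => sqnorm (X w) ^+ 3)
    (k%:R * (k%:R + 2) * (k%:R + 4));
  mean_dot : has_mean P (fun w => dot g (X w)) 0;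
  mean_dot2 : has_mean P (fun w => dot g (X w) ^+ 2) (\sum_i g i ^+ 2);
  mean_dot_sqnorm : has_mean P (fun w => dot g (X w) * sqnorm (X w)) 0;
  mean_dot2_sqnorm : has_mean P (fun w => dot g (X w) ^+ 2 * sqnorm (X w))
    ((k%:R + 2) * \sum_i g i ^+ 2) }.

(** Induction on the dimension. With [x] the first coordinate and [S], [G] the
    values of [sqnorm] and [dot] on the others, the new values are [x^2 + S] and
    [g0 x + G]; after expansion, every term is a power of [x] times a function of
    the independent tail, so that its mean is a product of known ones. *)
Lemma gaussian_momentsP d (T : measurableType d) (R : realType)
    (P : probability T R) (k : nat) (X : 'I_k -> T -> measurableTypeR R)
    (g : 'I_k -> R) :
  (forall i, measurable_fun setT (X i)) -> mutually_independent_RV P X ->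
  (forall i, normal_moments P (X i : T -> R)) ->
  gaussian_moments P (fun w => [tuple X i w | i < k]) g.
Proof.
elim: k X g => [|k IH] X g mX indX momX.
  have z (f : T -> R) : (forall w, f w = 0) -> has_mean P f 0.
    by move=> f0; apply: has_mean_eq (has_mean_cst P 0).
  split; rewrite ?mul0r ?big_ord0 ?mulr0; apply: z => w;
    by rewrite /sqnorm /dot ?big_ord0 ?expr0n ?mulr0.
have {}IH := IH _ (fun i => g (lift ord0 i)) (fun i => mX (lift ord0 i))
  (mutually_independent_tail indX) (fun i => momX (lift ord0 i)).
have indW := independent_head_tail mX indX.
set W := fun w => _ in IH indW.
have mW : measurable_fun setT W by exact: measurable_mktuple.
pose x : T -> R := X ord0; set g0 := g ord0; set g' := fun i => _ in IH.
have SE w : sqnorm [tuple X i w | i < k.+1] = x w ^+ 2 + sqnorm (W w).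
  rewrite /sqnorm big_ord_recl tnth_mktuple; congr (_ + _).
  by apply: eq_bigr => i _; rewrite !tnth_mktuple.
have GE w : dot g [tuple X i w | i < k.+1] = g0 * x w + dot g' (W w).
  rewrite /dot big_ord_recl tnth_mktuple; congr (_ + _).
  by apply: eq_bigr => i _; rewrite !tnth_mktuple.
have gE : \sum_i g i ^+ 2 = g0 ^+ 2 + \sum_i g' i ^+ 2 by rewrite big_ord_recl.
have mS := @measurable_sqnorm R k.
have mG := measurable_dot g'.
have prodM (f : k.-tuple R -> R) (j : nat) (a b : R) :
    measurable_fun setT (f : k.-tuple (measurableTypeR R) -> R) ->
    has_mean P (fun w => f (W w)) a -> has_mean P (fun w => x w ^+ j) b ->
    has_mean P (fun w => f (W w) * x w ^+ j) (a * b).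
  move=> mf Ef Ex.
  apply: (@has_meanM _ _ _ _ _ (measurableTypeR R) _ P W x f
    (fun r : R => r ^+ j)) => //; first exact: mX.
have [x1 x2 x3 x4 x6] : normal_moments P x := momX ord0.
have [S1 S2 S3 G1 G2 GS G2S] := IH.
have mS2 := measurable_funX 2 mS; have mG2 := measurable_funX 2 mG.
have mGS := measurable_funM mG mS.
have S1x2 := prodM _ 2 _ _ mS S1 x2.
have S1x4 := prodM _ 4 _ _ mS S1 x4.
have S2x2 := prodM _ 2 _ _ mS2 S2 x2.
have G1x1 := prodM _ 1 _ _ mG G1 x1.
have G1x2 := prodM _ 2 _ _ mG G1 x2.
have G1x3 := prodM _ 3 _ _ mG G1 x3.
have S1x1 := prodM _ 1 _ _ mS S1 x1.
have G2x2 := prodM _ 2 _ _ mG2 G2 x2.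
have GSx1 := prodM _ 1 _ _ mGS GS x1.
split.
- apply: has_mean_eq (has_meanD x2 S1) => [w|]; first by rewrite SE.
  by rewrite -[k.+1]addn1 natrD; ring.
- apply: has_mean_eq (has_meanD x4 (has_meanD (has_meanZ 2 S1x2) S2)) => [w|].
    by rewrite SE; ring.
  by rewrite -[k.+1]addn1 natrD; ring.
- apply: has_mean_eq (has_meanD x6 (has_meanD (has_meanZ 3 S1x4)
    (has_meanD (has_meanZ 3 S2x2) S3))) => [w|]; first by rewrite SE; ring.
  by rewrite -[k.+1]addn1 natrD; ring.
- apply: has_mean_eq (has_meanD (has_meanZ g0 x1) G1) => [w|]; last by ring.
  by rewrite GE.
- apply: has_mean_eq (has_meanD (has_meanZ (g0 ^+ 2) x2)
    (has_meanD (has_meanZ (2 * g0) G1x1) G2)) => [w|].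
    by rewrite GE; ring.
  by rewrite gE; ring.
- apply: has_mean_eq (has_meanD (has_meanZ g0 x3) (has_meanD
    (has_meanZ g0 S1x1) (has_meanD G1x2 GS))) => [w|]; last by ring.
  by rewrite GE SE; ring.
- apply: has_mean_eq (has_meanD (has_meanZ (g0 ^+ 2) x4) (has_meanD
    (has_meanZ (g0 ^+ 2) S1x2) (has_meanD (has_meanZ (2 * g0) G1x3)
    (has_meanD (has_meanZ (2 * g0) GSx1) (has_meanD G2x2 G2S))))) => [w|].
    by rewrite GE SE /=; ring.
  by rewrite gE -[k.+1]addn1 natrD; ring.
Qed.

Lemma standard_gaussian_moments d (T : measurableType d) (R : realType)
    (P : probability T R) (k : nat)
    (U : {RV P >-> k.-tuple (measurableTypeR R)}) (g : 'I_k -> R) :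
  standard_gaussian U -> gaussian_moments P (fun w => U w : k.-tuple R) g.
Proof.
move=> [indU lawU].
pose X i w : measurableTypeR R := tnth (U w) i.
have mX i : measurable_fun setT (X i).
  exact: (measurable_fun_tnthP U).1 (measurable_funPT U) i.
have momX i : normal_moments P (X i : T -> R).
  exact: normal_momentsP (mX i) (lawU i).
have -> : (fun w => U w : k.-tuple R) = (fun w => [tuple X i w | i < k]).
  by apply/funext => w; apply: eq_from_tnth => i; rewrite tnth_mktuple.
exact: gaussian_momentsP.
Qed.

(** * The zeroth-order gradient estimator *)

(** [(a + b)^2 <= 2 a^2 + 2 b^2], used for the linear part against the remainder
    and then within each of them. *)
Lemma sqr_le_quadratic_remainder (R : realType) (L A p r s t : R) :
  `|A - (p + r)| <= L / 2 * (s + t) ->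
  A ^+ 2 <= L ^+ 2 * (s ^+ 2 + t ^+ 2) + 4 * p ^+ 2 + 4 * r ^+ 2.
Proof.
set D := A - _; set e := L / 2 * _ => De.
have D2 : D ^+ 2 <= e ^+ 2.
  by rewrite -real_normK ?num_real// lerXn2r ?nnegrE ?(le_trans _ De).
have AD : A ^+ 2 <= 2 * D ^+ 2 + 2 * (p + r) ^+ 2.
  by rewrite -subr_ge0 (_ : _ - _ = (D - (p + r)) ^+ 2) ?sqr_ge0// /D; ring.
have pr : (p + r) ^+ 2 <= 2 * p ^+ 2 + 2 * r ^+ 2.
  by rewrite -subr_ge0 (_ : _ - _ = (p - r) ^+ 2) ?sqr_ge0//; ring.
have e2 : 2 * e ^+ 2 <= L ^+ 2 * (s ^+ 2 + t ^+ 2).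
  have sq_ge0 := mulr_ge0 (sqr_ge0 (L / 2 * (s - t))) (ler0n R 2).
  rewrite -subr_ge0; apply: le_trans sq_ge0 _.
  by rewrite le_eqVlt; apply/orP; left; apply/eqP; rewrite /e; field.
lra.
Qed.

(** The descent lemma at the increment [(eta u, mu v)]. The right-hand side is a
    linear combination of products whose means are known. *)
Lemma zo_gradient_x_sqnorm_le (R : realType) (n m : nat)
    (q : 'rV[R]_(n + m) -> R) (L : R) (x : 'rV[R]_n) (y : 'rV[R]_m)
    (eta mu : R) (u : n.-tuple R) (v : m.-tuple R) :
  C1_lipschitz setT L q -> 0 < eta ->
  enorm (zo_gradient_x q eta mu x y (row_of_tuple u) (row_of_tuple v)) ^+ 2 <=
    L ^+ 2 * eta ^+ 2 * sqnorm u ^+ 3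
    + (L ^+ 2 * mu ^+ 4 / eta ^+ 2 * (sqnorm u * sqnorm v ^+ 2)
    + (4 * (dot (gradient_x q x y ord0) u ^+ 2 * sqnorm u)
    + 4 * mu ^+ 2 / eta ^+ 2 *
        (sqnorm u * dot (gradient_y q x y ord0) v ^+ 2))).
Proof.
move=> hq eta0; rewrite /zo_gradient_x enormZ exprMn real_normK ?num_real//.
have -> : enorm (row_of_tuple u) ^+ 2 = sqnorm u.
  by rewrite enorm_sqr; apply: eq_bigr => i _; rewrite mxE.
rewrite -add_row_mx; set h := row_mx (eta *: _) _; set z := row_mx x y.
have normh : enorm h ^+ 2 = eta ^+ 2 * sqnorm u + mu ^+ 2 * sqnorm v.
  rewrite enorm_sqr big_split_ord /sqnorm !mulr_sumr; congr (_ + _);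
    by apply: eq_bigr => i _; rewrite ?row_mxEl ?row_mxEr !mxE exprMn.
have gradh : \sum_i gradient q z ord0 i * h ord0 i =
    eta * dot (gradient_x q x y ord0) u + mu * dot (gradient_y q x y ord0) v.
  rewrite big_split_ord /dot !mulr_sumr; congr (_ + _);
    by apply: eq_bigr => i _; rewrite ?row_mxEl ?row_mxEr !mxE mulrCA.
have := descent_lemma z h hq; rewrite gradh normh => /sqr_le_quadratic_remainder.
set A := q _ - q _; set p := dot _ u; set r := dot _ v => A2.
have S0 : 0 <= sqnorm u by apply: sumr_ge0 => i _; exact: sqr_ge0.
rewrite expr_div_n mulrAC ler_pdivrMr ?exprn_gt0//.
apply: le_trans (ler_wpM2r S0 A2) _.
rewrite le_eqVlt; apply/orP; left; apply/eqP; field.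
by rewrite gt_eqF.
Qed.

Theorem proposition2p4 (R : realType) (n m : nat)
    (hn : (1 <= n)%N) (hm : (1 <= m)%N)
    (q : 'rV[R]_(n + m) -> R) (L : R) (hq : C1_lipschitz setT L q)
    (x : 'rV[R]_n) (y : 'rV[R]_m) (eta mu : R) (heta : 0 < eta) (hmu : 0 <= mu)
    (d : measure_display) (T : measurableType d) (P : probability T R)
    (u : {RV P >-> n.-tuple (measurableTypeR R)})
    (v : {RV P >-> m.-tuple (measurableTypeR R)})
    (hu : standard_gaussian u) (hv : standard_gaussian v)
    (huv : independent_RV P u v) :
  ('E_P[(fun w => enorm (zo_gradient_x q eta mu x y
                           (row_of_tuple (u w)) (row_of_tuple (v w))) ^+ 2)%R]
   <= (L ^+ 2 * (eta ^+ 2 * (n%:R + 6) ^+ 3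
                 + mu ^+ 4 / eta ^+ 2 * n%:R * (m%:R + 4) ^+ 2)
       + 4 * (n%:R + 2) * enorm (gradient_x q x y) ^+ 2
       + 4 * mu ^+ 2 / eta ^+ 2 * n%:R * enorm (gradient_y q x y) ^+ 2)%:E)%E.
Proof.
have moment_u := standard_gaussian_moments (gradient_x q x y ord0) hu.
have moment_v := standard_gaussian_moments (gradient_y q x y ord0) hv.
have prodM (f : m.-tuple R -> R) (c : R) :
    measurable_fun setT (f : m.-tuple (measurableTypeR R) -> R) ->
    has_mean P (fun w => f (v w)) c ->
    has_mean P (fun w => sqnorm (u w : n.-tuple R) * f (v w)) (n%:R * c).
  move=> mf Ef.
  apply: (@has_meanM _ _ _ _ (n.-tuple (measurableTypeR R))
    (m.-tuple (measurableTypeR R)) _ P u v (@sqnorm R n) f) => //.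
  - exact: measurable_sqnorm.
  - exact: mean_sqnorm moment_u.
have uv2 := prodM _ _ (measurable_funX 2 (@measurable_sqnorm R m))
  (mean_sqnorm2 moment_v).
have ud2 := prodM _ _
  (measurable_funX 2 (measurable_dot (gradient_y q x y ord0)))
  (mean_dot2 moment_v).
(* the terms come in the order of the bound of [zo_gradient_x_sqnorm_le] *)
have [_ Ebound] := has_meanD
  (has_meanZ (L ^+ 2 * eta ^+ 2) (mean_sqnorm3 moment_u))
  (has_meanD (has_meanZ (L ^+ 2 * mu ^+ 4 / eta ^+ 2) uv2)
  (has_meanD (has_meanZ 4 (mean_dot2_sqnorm moment_u))
    (has_meanZ (4 * mu ^+ 2 / eta ^+ 2) ud2))).
have bound w := zo_gradient_x_sqnorm_le x y mu (u w) (v w) hq heta.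
have {}bound w : (((enorm (zo_gradient_x q eta mu x y (row_of_tuple (u w))
    (row_of_tuple (v w))) ^+ 2)%:E <= _)%E) := etrans (lee_fin _ _) (bound w).
rewrite unlock; apply: le_trans.
  apply: ge0_le_integralT_nonmeasurable => w; last exact: bound.
  by rewrite lee_fin sqr_ge0.
rewrite Ebound lee_fin !enorm_sqr.
set gx := \sum_i _; set gy := \sum_i _.
have n0 : (0 : R) <= n%:R by exact: ler0n.
have m0 : (0 : R) <= m%:R by exact: ler0n.
have n3 : n%:R * (n%:R + 2) * (n%:R + 4) <= (n%:R + 6) ^+ 3 :> R by nra.
have m2 : m%:R * (m%:R + 2) <= (m%:R + 4) ^+ 2 :> R by nra.
have c1 : 0 <= L ^+ 2 * eta ^+ 2 by rewrite mulr_ge0 ?sqr_ge0.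
have c2 : 0 <= L ^+ 2 * mu ^+ 4 / eta ^+ 2 * n%:R.
  apply: mulr_ge0 => //; apply: divr_ge0; last exact: sqr_ge0.
  by apply: mulr_ge0; [exact: sqr_ge0|exact: exprn_ge0].
have := lerD (ler_wpM2l c1 n3) (ler_wpM2l c2 m2).
lra.
Qed.
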